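(* Let $n\ge3$. Consider the action on complex symmetric $n\times n$ matrices $H$ given by $H\mapsto a\bar d\,BHB^\tau$, where $B=\begin{pmatrix}V&c\\0&d\end{pmatrix}$ with $c\in\mathbb{C}^{n-1}$, $d\in\mathbb{C}\setminus\{0\}$, $a>0$ and $\sqrt a\,V\in U(\mathbb{C}^{n-1})$ (these are exactly the changes of bases preserving the normalized Levi form $\tilde I=\operatorname{diag}(1,\dots,1,0)$, acting on the matrix $H=(h_{\bar\alpha\bar\beta n})$ of the third order tensor of a hypersurface at a point where the Levi form has rank $n-1$ and is semidefinite). Then every symmetric $H$ can be brought by this action to precisely one of the following block matrices: (i) $\begin{pmatrix}D_{n-1}(\lambda)&e_{n-1}\\ e_{n-1}^\tau&0\end{pmatrix}$ with $\lambda=(1,\lambda_2,\dots,\lambda_{n-2},0)$, $1\ge\lambda_2\ge\dots\ge\lambda_{n-2}\ge0$, or $\lambda=0$; (ii) $\begin{pmatrix}D_{n-1}(\lambda)&0\\0&0\end{pmatrix}$ with $\lambda=(1,\lambda_2,\dots,\lambda_{n-1})$, $1\ge\lambda_2\ge\dots\ge\lambda_{n-1}\ge0$, or $\lambda=0$; (iii) $\begin{pmatrix}D_{n-1}(\lambda)&0\\0&1\end{pmatrix}$ with $\lambda=(1,\lambda_2,\dots,\lambda_{n-1})$, $1\ge\lambda_2\ge\dots\ge\lambda_{n-1}\ge0$, or $\lambda=0$; with the form and $\lambda$ uniquely determined. For $n=2$ the same holds with: in (i) only $\lambda=0$; in (ii) and (iii) $\lambda\in\{0,1\}$.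
   Context: $D_{n-1}(\lambda)$ is the diagonal $(n-1)\times(n-1)$ matrix with diagonal $\lambda$; $e_{n-1}=(0,\dots,0,1)^\tau\in\mathbb{C}^{n-1}$ (for $n=2$, $e_1=1$); $U(\mathbb{C}^{n-1})$ is the unitary group. *)

(* Defs.v *)
From HB Require Import structures.
From mathcomp Require Import all_boot all_order all_algebra.
From mathcomp Require Import complex.
From mathcomp Require Import reals.
Set Implicit Arguments. Unset Strict Implicit. Unset Printing Implicit Defensive.
Import Order.TTheory GRing.Theory Num.Theory.
Local Open Scope ring_scope.
Local Open Scope complex_scope.

(* Throughout, n >= 2 is the dimension, m := n.-1, and n x n matrices are
   written with type 'M_(m + 1) so that block decompositions are available. *)

Definition unitary_mx (R : rcfType) (m : nat) (W : 'M[R[i]]_m) : Prop :=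
  W *m (map_mx Num.conj W)^T = 1%:M.

Definition Bmx (R : rcfType) (m : nat) (V : 'M[R[i]]_m) (c : 'cV[R[i]]_m)
  (d : R[i]) : 'M[R[i]]_(m + 1) :=
  block_mx V c 0 d%:M.

Definition act (R : rcfType) (m : nat) (a : R) (V : 'M[R[i]]_m)
  (c : 'cV[R[i]]_m) (d : R[i]) (H : 'M[R[i]]_(m + 1)) : 'M[R[i]]_(m + 1) :=
  ((a%:C)%C * Num.conj d) *: (Bmx V c d *m H *m (Bmx V c d)^T).

Definition reaches (R : rcfType) (m : nat) (H H' : 'M[R[i]]_(m + 1)) : Prop :=
  exists (a : R) (V : 'M[R[i]]_m) (c : 'cV[R[i]]_m) (d : R[i]),
    [/\ 0 < a, d != 0, unitary_mx ((Num.sqrt a)%:C%C *: V)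
      & H' = act a V c d H].

Definition Dmx (R : rcfType) (m : nat) (l : 'I_m -> R) : 'M[R[i]]_m :=
  diag_mx (\row_j (l j)%:C%C).

Definition evec (R : rcfType) (m : nat) : 'cV[R[i]]_m :=
  \col_j (if val j == m.-1 then 1 else 0).

Inductive nf_kind := Kind1 | Kind2 | Kind3.

Definition NF (R : rcfType) (m : nat) (k : nf_kind) (l : 'I_m -> R)
  : 'M[R[i]]_(m + 1) :=
  match k with
  | Kind1 => block_mx (Dmx l) (evec R m) (evec R m)^T 0
  | Kind2 => block_mx (Dmx l) 0 0 0
  | Kind3 => block_mx (Dmx l) 0 0 1%:M
  end.

Definition lam_chain (R : rcfType) (m : nat) (l : 'I_m -> R) : Prop :=
  [/\ forall j : 'I_m, 0 <= l j <= 1,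
      forall j k : 'I_m, (j <= k)%N -> l k <= l j
    & forall j : 'I_m, val j = 0%N -> l j = 1].

Definition nf_valid (R : rcfType) (m : nat) (k : nf_kind) (l : 'I_m -> R)
  : Prop :=
  (forall j, l j = 0) \/
  match k with
  | Kind1 => lam_chain l /\ (forall j : 'I_m, val j = m.-1 -> l j = 0)
  | Kind2 | Kind3 => lam_chain l
  end.

(* Main.v *)
(* Write H = [S, b; b^T, h].  The action preserves which of h <> 0, "h = 0 and
   b <> 0", "h = 0 and b = 0" holds, and this selects the kind.  If h <> 0,
   completing the square with c removes b; if h = 0 and b <> 0, a unitary change
   makes b a multiple of e and then c clears the last row and column of S.  In all
   cases there remains a symmetric block acted on by S |-> z U S U^T with U unitary,
   so Takagi's factorization U S U^T = diag(l), l >= 0, applies; |d| rescales l,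
   while a compensates in b and h.  Conversely D' = z W D W^T, with D = diag(l) and
   D' = diag(l'), implies that D'^2 and |z|^2 D^2 are similar, so l' = |z| l once
   both are sorted, and |z| is pinned down by the leading entry 1. *)

Require Import Defs.
From HB Require Import structures.
From mathcomp Require Import all_boot all_order all_algebra.
From mathcomp Require Import fingroup perm.
From mathcomp Require Import ring.
From mathcomp Require Import complex.
From mathcomp Require Import reals.
Import Order.TTheory GRing.Theory Num.Theory.
Local Open Scope ring_scope.

(** * Takagi factorization of complex symmetric matrices *)

Section Takagi.
Variable C : numClosedFieldType.
Local Notation mxC := (map_mx Num.conj).

(** Gram-Schmidt is applied to the matrix all of whose rows are [u]: the first row of the result is
    [u] normalized, and a transposition of rows moves it to position [i]. *)
Lemma unitary_row_ext (n : nat) (u : 'rV[C]_n) (i : 'I_n) : u != 0 ->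
  exists (U : 'M[C]_n) (c : C), [/\ U \is unitarymx, 0 < c & row i U = c *: u].
Proof.
case: n u i => [|n] u i u0; first by case: i.
pose A : 'M[C]_n.+1 := \matrix_(i, j) u 0 j.
have rowA : row 0 A = u by apply/rowP=> j; rewrite !mxE.
pose B := schmidt A.
have B_un : B \is unitarymx by apply: schmidt_unitarymx.
(* Row 0 of [A] lies in the span of the rows of [B] of index at most 0, so [u] is a multiple of row
   0 of [B]. *)
have := row_schmidt_sub A 0; rewrite rowA (big_pred1 0) => [|k]; last first.
  by rewrite leqn0.
rewrite genmxE => /sub_rVP[k uE].
(* The factor [k] is the scalar product of row 0 of [A] with row 0 of [B], which Gram-Schmidt makes
   nonnegative. *)
have k_ge0 : 0 <= k.
  have := form1_row_schmidt A 0; rewrite rowA uE linearZl_LR /=.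
  by rewrite -/B (row_unitarymxP B_un) eqxx mulr1.
have k_gt0 : 0 < k.
  by rewrite lt0r k_ge0 andbT; apply: contraNneq u0 => k0; rewrite uE k0 scale0r.
exists (perm_mx (tperm i 0) *m B), k^-1; split.
- apply: mul_unitarymx => //; apply/unitarymxP.
  by rewrite tr_perm_mx map_perm_mx -perm_mxM mulgV perm_mx1.
- by rewrite invr_gt0.
- rewrite [in RHS]uE -row_permE scalerA mulVf ?gt_eqF // scale1r.
  by apply/rowP=> j; rewrite !mxE tpermL.
Qed.

(* The antilinear map [x |-> conj (x S)] squares to [x |-> x S conj(S)], so on
   an eigenvector [x] of the latter, with eigenvalue [t^2], either
   [conj (x S) + t x] or, if that vanishes, ['i x] is fixed up to the factor [t]. *)
Lemma exists_coneigenvector (n : nat) (S : 'M[C]_n.+1) : S^T = S ->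
  exists (u : 'rV[C]_n.+1) (t : C), [/\ u != 0, 0 <= t & u *m S = t *: mxC u].
Proof.
move=> Ssym; have [a /eigenvalueP[x xE x0]] := eigenvalue_closed (S *m mxC S) (ltn0Sn n).
(* By symmetry of [S], the squared norm of [x S] is [x S conj(S) x^* = a |x|^2]. *)
have a_ge0 : 0 <= a.
  have xx_gt0 : 0 < dotmx x x by rewrite dnorm_gt0.
  have : 0 <= dotmx (x *m S) (x *m S) by apply: dnorm_ge0.
  rewrite dotmxE trmx_mul map_mxM Ssym mulmxA -(mulmxA x) xE -scalemxAl mxE -dotmxE.
  by rewrite pmulr_lge0.
pose t := sqrtC a; have t_ge0 : 0 <= t by rewrite sqrtC_ge0.
have tt : t * t = a by rewrite -expr2 sqrtCK.
have tC : t^* = t by apply: conj_Creal; apply: ger0_real.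
pose y := mxC (x *m S).
have yC : mxC y = x *m S by apply/matrixP=> i j; rewrite !mxE conjCK.
have yS : y *m S = a *: mxC x.
  have SCC : mxC (mxC S) = S by apply/matrixP=> i j; rewrite !mxE conjCK.
  by rewrite -[in LHS]SCC -map_mxM -mulmxA xE map_mxZ -tt rmorphM /= tC.
have [z0|z0] := eqVneq (y + t *: x) 0; last first.
  exists (y + t *: x), t; split => //.
  rewrite mulmxDl yS -scalemxAl map_mxD map_mxZ /= tC yC.
  by rewrite scalerDr scalerA tt addrC.
exists ('i *: x), t; split => //.
  by rewrite scaler_eq0 negb_or x0 neq0Ci.
move/eqP: z0; rewrite addr_eq0 => /eqP yE.
have -> : 'i *: x *m S = 'i *: mxC y by rewrite yC scalemxAl.
rewrite yE map_mxN !map_mxZ /= conjCi tC scaleNr !scalerN !scalerA.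
by rewrite [t * _]mulrC.
Qed.

Lemma block_unitary (m n : nat) (U : 'M[C]_m) (V : 'M[C]_n) :
  U \is unitarymx -> V \is unitarymx -> block_mx U 0 0 V \is unitarymx.
Proof.
move=> /unitarymxP UU /unitarymxP VV; apply/unitarymxP.
rewrite tr_block_mx map_block_mx mulmx_block !trmx0 !map_mx0 UU VV.
by rewrite !mul0mx !mulmx0 !addr0 add0r -scalar_mx_block.
Qed.

(** Deflation: once a coneigenvector is, up to scale, the first row of a unitary [U], the matrix
    [U S U^T] has first row [(t, 0, ..., 0)]. By symmetry it splits into [t] and a smaller symmetric
    block, to which induction applies. *)
Theorem takagi (n : nat) (S : 'M[C]_n) : S^T = S ->
  exists (U : 'M[C]_n) (d : 'rV[C]_n),
    [/\ U \is unitarymx, forall j, 0 <= d 0 j & U *m S *m U^T = diag_mx d].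
Proof.
elim: n S => [|n IHn] S Ssym.
  exists 1%:M, 0; split; last by apply/matrixP=> -[].
    by apply/unitarymxP; rewrite trmx1 map_mx1 mulmx1.
  by case.
have [u [t [u0 t_ge0 uS]]] := exists_coneigenvector _ S Ssym.
have [U [c [U_un c_gt0 rowU]]] := @unitary_row_ext (1 + n) u 0 u0.
have UUt : U *m mxC U^T = 1%:M by apply/unitarymxP.
have [M ME] : {M : 'M[C]_(1 + n) | M = U *m S *m U^T} by eexists.
have Msym : M^T = M by rewrite ME !trmx_mul trmxK Ssym mulmxA.
(* With [c u] as row 0 of [U] and [c] real, row 0 of [M] is [c u S U^T = t conj(c u) U^T], that is,
   [t] times row 0 of [conj(U) U^T = 1]. *)
have rowM : row 0 M = t *: row 0 1%:M.
  have cC : c^* = c by apply: conj_Creal; apply: gtr0_real.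
  have UtU : mxC U *m U^T = 1%:M.
    have <- : mxC (mxC U^T) = U^T by apply/matrixP=> i j; rewrite !mxE conjCK.
    by rewrite -map_mxM UUt map_mx1.
  rewrite ME !row_mul rowU -scalemxAl uS scalerA mulrC -scalerA.
  have -> : c *: mxC u = row 0 (mxC U) by rewrite -map_row rowU map_mxZ /= cC.
  by rewrite -scalemxAl -row_mul UtU.
have MulE (j : 'I_(1 + n)) : M 0 j = t * (0 == j)%:R.
  by have /rowP/(_ j) := rowM; rewrite !mxE.
have Mul : ulsubmx M = t%:M.
  by apply/matrixP=> i j; rewrite !ord1 !mxE lshift0 MulE eqxx mulr1 mulr1n.
have Mur : ursubmx M = 0.
  by apply/matrixP=> i j; rewrite !ord1 !mxE lshift0 MulE mulr0.
have Mdl : dlsubmx M = 0 by rewrite -[M]Msym -trmx_ursub Mur trmx0.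
have [V [d [V_un d_ge0 VE]]] := IHn (drsubmx M) ltac:(by rewrite trmx_drsub Msym).
exists (block_mx 1%:M 0 0 V *m (U : 'M_(1 + n))), (row_mx t%:M d); split.
- apply: (@mul_unitarymx _ (1 + n) (1 + n) (1 + n)) => //.
  apply: (@block_unitary 1 n) => //.
  by apply/unitarymxP; rewrite trmx1 map_mx1 mulmx1.
- move=> j; rewrite mxE; case: splitP => k _ //.
  by rewrite !mxE ord1.
- have WUE (W : 'M[C]_(1 + n)) : W *m U *m S *m (W *m U)^T = W *m M *m W^T.
    by rewrite ME trmx_mul !mulmxA.
  rewrite WUE tr_block_mx -[M]submxK Mul Mur Mdl !mulmx_block.
  rewrite ?(trmx0, trmx1, mul0mx, mulmx0, mul1mx, mulmx1, addr0, add0r).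
  rewrite VE; apply: etrans (esym (diag_mx_row t%:M d)); congr block_mx.
  by apply/matrixP=> i j; rewrite !ord1 !mxE.
Qed.

End Takagi.

(** * Sorted Takagi values and their uniqueness up to scale *)

Section SingularValues.
Variable R : rcfType.
Local Notation mxC := (map_mx Num.conj).

(** The conditions on the diagonal that survive positive rescaling, before the leading entry is
    normalized. *)
Definition nonneg_desc (m : nat) (l : 'I_m -> R) : Prop :=
  (forall j, 0 <= l j) /\ (forall j k : 'I_m, (j <= k)%N -> l k <= l j).

Lemma perm_nonincreasing (m : nat) (f : 'I_m -> R) :
  exists s : 'S_m, forall j k : 'I_m, (j <= k)%N -> f (s k) <= f (s j).
Proof.
pose t := [tuple f i | i < m].
have /tuple_permP[s sE] : perm_eq (sort >=%R t) t by rewrite perm_sort.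
have nthE (j : 'I_m) : nth 0 (sort >=%R t) j = f (s j).
  by rewrite sE -tnth_nth !tnth_mktuple.
exists s => j k jk; rewrite -!nthE.
have tr : transitive (>=%R : rel R) by move=> a b c ab ca; apply: le_trans ca ab.
apply: (sorted_leq_nth tr (@lexx _ R)) => //; last 2 first.
- by rewrite inE size_sort size_tuple.
- by rewrite inE size_sort size_tuple.
by apply: (@sort_sorted R >=%R) => a b; apply: le_total.
Qed.

(** A permutation matrix is real and unitary, so sorting the diagonal is absorbed into [U]. *)
Lemma takagi_desc (m : nat) (S : 'M[R[i]]_m) : S^T = S ->
  exists (U : 'M[R[i]]_m) (l : 'I_m -> R),
    [/\ U \is unitarymx, nonneg_desc m l & U *m S *m U^T = Dmx l].
Proof.
move=> /takagi[U [d [U_un d_ge0 UE]]].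
pose f j : R := complex.Re (d 0 j).
have dE j : d 0 j = (f j)%:C%C by rewrite RRe_real // ger0_real.
have [s s_desc] := perm_nonincreasing m f.
exists (perm_mx s *m U), (fun j => f (s j)); split.
- apply: mul_unitarymx => //; apply/unitarymxP.
  by rewrite tr_perm_mx map_perm_mx -perm_mxM mulgV perm_mx1.
- by split=> // j; rewrite -ler0c -dE.
- rewrite trmx_mul -!mulmxA (mulmxA U) (mulmxA _ U^T) UE tr_perm_mx.
  rewrite -col_permE -row_permE; apply/matrixP=> i j.
  by rewrite !mxE (inj_eq perm_inj) dE.
Qed.

Lemma char_poly_conjmx (F : fieldType) (m : nat) (W V A : 'M[F]_m) :
  W *m V = 1%:M -> char_poly (W *m A *m V) = char_poly A.
Proof.
move=> WV; rewrite /char_poly /char_poly_mx.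
have WVP : map_mx polyC W *m map_mx polyC V = 1%:M by rewrite -map_mxM WV map_mx1.
have -> : 'X%:M - map_mx polyC (W *m A *m V)
    = map_mx polyC W *m ('X%:M - map_mx polyC A) *m map_mx polyC V.
  by rewrite mulmxBr mulmxBl !map_mxM /= mul_mx_scalar -scalemxAl WVP scalemx1.
rewrite !det_mulmx mulrC mulrA -det_mulmx.
by rewrite (mulmx1C WVP) det1 mul1r.
Qed.

(** Multiplying each side by its conjugate transpose removes the phase of [z] and turns the
    congruence by [W] into a unitary conjugation of squares. Equal characteristic polynomials then
    give equal multisets of squares, and sorting matches them entry by entry, with [t = |z|]. *)
Lemma Dmx_congr_scale (m : nat) (l l' : 'I_m -> R) (W : 'M[R[i]]_m) (z : R[i]) :
  nonneg_desc m l -> nonneg_desc m l' -> W \is unitarymx -> z != 0 ->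
  Dmx l' = z *: (W *m Dmx l *m W^T) -> exists2 t : R, 0 < t & forall j, l' j = t * l j.
Proof.
move=> [l_ge0 l_desc] [l'_ge0 l'_desc] W_un z0 E.
pose t : R := ComplexField.Normc.normc z.
have tE : `|z| = t%:C%C by [].
have t_gt0 : 0 < t by rewrite -ltcR -tE normr_gt0.
have DD (f : 'I_m -> R) : Dmx f *m mxC (Dmx f)^T = Dmx (fun j => f j ^+ 2).
  rewrite tr_diag_mx map_diag_mx mulmx_diag; congr diag_mx.
  apply/rowP=> j; rewrite !mxE /= conj_Creal ?complex_real //.
  by rewrite -expr2 rmorphXn.
have DDE : Dmx (fun j => l' j ^+ 2) = W *m Dmx (fun j => (t * l j) ^+ 2) *m mxC W^T.
  have WtW : W^T *m mxC W = 1%:M.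
    by rewrite -[W in mxC W]trmxK; apply/unitarymxP; rewrite trmx_unitary.
  have -> : Dmx (fun j => (t * l j) ^+ 2) = (z * z^*) *: Dmx (fun j => l j ^+ 2).
    rewrite -normCK tE -rmorphXn; apply/matrixP=> i j; rewrite !mxE.
    by rewrite exprMn rmorphM mulrnAr.
  rewrite -!DD E linearZ map_mxZ /= -scalemxAl -scalemxAr scalerA -scalemxAr -scalemxAl.
  congr (_ *: _); rewrite !trmx_mul trmxK !map_mxM !mulmxA.
  by rewrite -(mulmxA _ W^T) WtW mulmx1.
have cpD (f : 'I_m -> R) : char_poly (Dmx f)
    = \prod_(x <- [seq (f j)%:C%C | j : 'I_m]) ('X - x%:P).
  rewrite char_poly_trig ?diag_mx_is_trig // big_image /=.
  by apply: eq_bigr => j _; rewrite !mxE eqxx.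
have : perm_eq [seq (l' j ^+ 2)%:C%C | j : 'I_m] [seq ((t * l j) ^+ 2)%:C%C | j : 'I_m].
  apply: prod_XsubC_eq; rewrite -!cpD DDE char_poly_conjmx //.
  exact/unitarymxP.
(* The enumeration of ['I_m] is increasing, so a nonincreasing function lists its values in sorted
   order. *)
have sorted_image (f : 'I_m -> R) : (forall j k : 'I_m, (j <= k)%N -> f k <= f j) ->
    sorted >=%R [seq f j | j : 'I_m].
  move=> f_desc; apply: (homo_sorted (e := fun j k : 'I_m => (j <= k)%N)).
    by move=> j k; apply: f_desc.
  by have := iota_sorted 0 m; rewrite -val_enum_ord sorted_map.
have RC (f : 'I_m -> R) : [seq (f j)%:C%C | j : 'I_m]
    = [seq x%:C%C | x <- [seq f j | j : 'I_m]] by rewrite -map_comp.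
rewrite !RC => /(perm_map_inj (@complexI R)) lE.
have tl_ge0 j : 0 <= t * l j by rewrite mulr_ge0 // ltW.
exists t => // j; apply/eqP; rewrite -(@eqrXn2 _ 2) //; apply/eqP.
have /eq_in_map : [seq l' j ^+ 2 | j : 'I_m] = [seq (t * l j) ^+ 2 | j : 'I_m].
  apply: (sorted_eq (leT := >=%R)) lE.
  - by move=> a b c ab ca; apply: le_trans ca ab.
  - by move=> a b; rewrite andbC => /le_anti.
  - by apply: sorted_image => i k ik; rewrite lerXn2r ?nnegrE ?l'_desc.
  - by apply: sorted_image => i k ik; rewrite lerXn2r ?nnegrE // ler_pM2l ?l_desc.
by apply; rewrite mem_enum.
Qed.

End SingularValues.

(** * The group action: composition, inverses and block formula *)

Section GroupAction.
Variable R : rcfType.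

Lemma unitary_mxP (m : nat) (W : 'M[R[i]]_m) : unitary_mx W <-> W \is unitarymx.
Proof. by rewrite /unitary_mx map_trmx; split=> /unitarymxP. Qed.

Lemma act_comp (m : nat) (a a' : R) (V V' : 'M[R[i]]_m) (c c' : 'cV[R[i]]_m)
    (d d' : R[i]) (H : 'M[R[i]]_(m + 1)) :
  act a V c d (act a' V' c' d' H)
    = act (a * a') (V *m V') (V *m c' + d' *: c) (d * d') H.
Proof.
have BE : Bmx (V *m V') (V *m c' + d' *: c) (d * d') = Bmx V c d *m Bmx V' c' d'.
  rewrite /Bmx mulmx_block !mulmx0 !mul0mx !addr0 add0r mul_mx_scalar.
  by rewrite -scalar_mxM.
rewrite /act BE trmx_mul -scalemxAr -scalemxAl scalerA !mulmxA rmorphM.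
by congr (_ *: _); rewrite rmorphM /= mulrACA.
Qed.

Lemma reaches_trans (m : nat) (H H' H'' : 'M[R[i]]_(m + 1)) :
  reaches H H' -> reaches H' H'' -> reaches H H''.
Proof.
move=> [a [V [c [d [a0 d0 /unitary_mxP V_un ->]]]]].
move=> [a' [V' [c' [d' [a'0 d'0 /unitary_mxP V'_un ->]]]]].
rewrite act_comp; do 4!eexists; split; last by reflexivity.
- by rewrite mulr_gt0.
- by rewrite mulf_neq0.
- apply/unitary_mxP.
  have scaleM (x y : R[i]) A B : (y * x) *: (A *m B) = (y *: A) *m (x *: B) :> 'M_m.
    by rewrite -scalemxAl -scalemxAr scalerA.
  rewrite (sqrtrM _ (ltW a'0)) rmorphM scaleM.
  exact: mul_unitarymx V'_un V_un.
Qed.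

Lemma reaches_sym (m : nat) (H H' : 'M[R[i]]_(m + 1)) :
  reaches H H' -> reaches H' H.
Proof.
move=> [a [V [c [d [a0 d0 /unitary_mxP V_un ->]]]]].
set s := (Num.sqrt a)%:C%C in V_un.
have s0 : s != 0 by rewrite /s (inj_eq (@complexI _) _ 0) gt_eqF ?sqrtr_gt0.
pose U := s *: V; have U_un : U \is unitarymx := V_un.
have UU : invmx U *m U = 1%:M by exact: mulVmx (unitarymx_unit U_un).
(* These are the blocks of the inverse of [Bmx V c d]: as [U = s V], the inverse of [V] is
   [s U^-1]. *)
exists a^-1, (s *: invmx U), (- d^-1 *: (s *: invmx U *m c)), d^-1; split.
- by rewrite invr_gt0.
- by rewrite invr_eq0.
- apply/unitary_mxP; rewrite scalerA (sqrtrV (ltW a0)) fmorphV (mulVf s0) scale1r.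
  by rewrite (invmx_unitary U_un) trmxC_unitary.
- have VV : s *: invmx U *m V = 1%:M.
    by rewrite -scalemxAl -UU /U scalemxAr.
  rewrite act_comp VV (mulVf d0) (mulVf (lt0r_neq0 a0)) scalerA mulrN (mulfV d0) scaleN1r subrr.
  rewrite /act /Bmx -scalar_mx_block trmx1 mul1mx mulmx1.
  by rewrite !rmorph1 mulr1 scale1r.
Qed.

(* Here [r] is [sqrt a], and [U], [c] are [sqrt a] times the [V], [c] of [act]. *)
Lemma reaches_blockP (m : nat) (S : 'M[R[i]]_m) (b : 'cV[R[i]]_m) (h : R[i]) H' :
  reaches (block_mx S b b^T h%:M) H' <->
  exists (r : R) (U : 'M[R[i]]_m) (c : 'cV[R[i]]_m) (d : R[i]),
    let k := r%:C%C * d^* * d in let b' := k *: (U *m b + h *: c) in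
    [/\ 0 < r, d != 0, U \is unitarymx
      & H' = block_mx
          (d^* *: (U *m S *m U^T + U *m b *m c^T + c *m (U *m b)^T + h *: (c *m c^T)))
          b' b'^T (k * r%:C%C * d * h)%:M].
Proof.
have actE r (U : 'M[R[i]]_m) c d : 0 < r ->
  act (r ^+ 2) (r^-1%:C%C *: U) (r^-1%:C%C *: c) d (block_mx S b b^T h%:M) =
  let k := r%:C%C * d^* * d in let b' := k *: (U *m b + h *: c) in
  block_mx (d^* *: (U *m S *m U^T + U *m b *m c^T + c *m (U *m b)^T + h *: (c *m c^T)))
          b' b'^T (k * r%:C%C * d * h)%:M.
  move=> r0 /=; have rq : r%:C%C * r^-1%:C%C = 1 by rewrite -rmorphM mulfV ?gt_eqF.
  set q := r^-1%:C%C in rq *.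
  (* The diagonal block carries [q] twice and the off-diagonal ones once, so [a = r^2] cancels
     entirely in the first and leaves one [r] in the others. *)
  have kq2 : (r ^+ 2)%:C%C * d^* * q * q = d^*.
    by rewrite rmorphXn -[RHS]mul1r -[in RHS](expr1n _ 2) -rq exprMn; ring.
  have kqd : (r ^+ 2)%:C%C * d^* * q * d = r%:C%C * d^* * d.
    rewrite rmorphXn -[r%:C%C in RHS]mulr1 -rq; ring.
  rewrite /act /Bmx tr_block_mx !mulmx_block !tr_scalar_mx !trmx0 !mul0mx !mulmx0.
  rewrite !add0r scale_block_mx.
  have linE (A : 'M[R[i]]_m) (x : 'cV[R[i]]_m) : (q *: A)^T = q *: A^T /\ (q *: x)^T = q *: x^T.
    by rewrite !linearZ.
  have [-> ->] := linE U c.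
  have cbE : q *: c *m h%:M = q *: (h *: c) by rewrite mul_mx_scalar scalerA mulrC -scalerA.
  have bdE : d%:M *m b^T = d *: b^T by rewrite mul_scalar_mx.
  rewrite cbE bdE -[q *: U *m S]scalemxAl -[q *: c *m b^T]scalemxAl -[q *: U *m b]scalemxAl.
  rewrite -!scalerDr; congr block_mx.
  - rewrite -!scalemxAr -!scalemxAl -!scalerDr !scalerA kq2; congr (_ *: _).
    rewrite !mulmxDl -scalemxAl trmx_mul mulmxA -!addrA; congr (_ + _).
    by rewrite addrC -!addrA; congr (_ + _); rewrite addrC.
  - by rewrite mul_mx_scalar !scalerA mulrAC kqd.
  - have trE (k : R[i]) (x y : 'cV[R[i]]_m) : (k *: (x + h *: y))^T = k *: (x^T + h *: y^T).
      by apply/matrixP=> i j; rewrite !mxE.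
    rewrite trE trmx_mul.
    have -> : d *: b^T *m (q *: U^T) + d%:M *m h%:M *m (q *: c^T)
        = (d * q) *: (b^T *m U^T + h *: c^T).
      rewrite -scalar_mxM mul_scalar_mx -scalemxAl -scalemxAr scalerDr !scalerA.
      by congr (_ + _ *: _); ring.
    by rewrite scalerA [d * q]mulrC mulrA kqd.
  - by rewrite -!scalar_mxM scale_scalar_mx rmorphXn; congr _%:M; ring.
split=> [[a [V [c [d [a0 d0 /unitary_mxP V_un ->]]]]]|[r [U [c [d [r0 d0 U_un ->]]]]]].
  set s := (Num.sqrt a) in V_un.
  have s0 : 0 < s by rewrite sqrtr_gt0.
  exists s, (s%:C%C *: V), (s%:C%C *: c), d; split=> //.
  have /= <- := actE s (s%:C%C *: V) (s%:C%C *: c) d s0.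
  rewrite !scalerA -!rmorphM (mulVf (lt0r_neq0 s0)) rmorph1 !scale1r.
  by rewrite (sqr_sqrtr (ltW a0)).
exists (r ^+ 2), (r^-1%:C%C *: U), (r^-1%:C%C *: c), d; split=> //.
- by rewrite exprn_gt0.
- apply/unitary_mxP; rewrite sqrtr_sqr (gtr0_norm r0) scalerA -rmorphM (mulfV (lt0r_neq0 r0)).
  by rewrite rmorph1 scale1r.
- by rewrite (actE r U c d r0).
Qed.

End GroupAction.

(** * Reduction to a normal form, up to rescaling of the diagonal *)

Section NormalForms.
Variable R : rcfType.
Local Notation mxC := (map_mx Num.conj).

Lemma scalar_mx0 (m : nat) : 0%:M = 0 :> 'M[R[i]]_m.
Proof. exact: raddf0. Qed.

(** With [nf_corner], this gives the three kinds one common block shape, to which [reaches_blockP]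
    applies. *)
Definition nf_col (m : nat) (k : nf_kind) : 'cV[R[i]]_m :=
  if k is Kind1 then evec R m else 0.

Definition nf_corner (k : nf_kind) : R[i] := if k is Kind3 then 1 else 0.

Lemma NFE (m : nat) (k : nf_kind) (l : 'I_m -> R) :
  NF k l = block_mx (Dmx l) (nf_col m k) (nf_col m k)^T (nf_corner k)%:M.
Proof. by case: k => /=; rewrite ?trmx0 ?scalar_mx0. Qed.

(** Validity of a normal form without the normalization of the leading entry. *)
Definition nf_desc (m : nat) (k : nf_kind) (l : 'I_m -> R) : Prop :=
  nonneg_desc R m l /\ (k = Kind1 -> forall j : 'I_m, val j = m.-1 -> l j = 0).

(** The choice [c = - h^-1 U b] clears the last column and leaves the Schur complement
    [S - h^-1 b b^T] in the diagonal block. *)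
Lemma reaches_corner (m : nat) (S : 'M[R[i]]_m) (b : 'cV[R[i]]_m) (h : R[i]) :
  S^T = S -> h != 0 -> exists l : 'I_m -> R,
  nonneg_desc R m l /\ reaches (block_mx S b b^T h%:M) (NF Kind3 l).
Proof.
move=> Ssym h0.
pose N : R := ComplexField.Normc.normc h; have NE : `|h| = N%:C%C by [].
have N_gt0 : 0 < N by rewrite -ltcR -NE normr_gt0.
have NC0 : N%:C%C != 0 by rewrite -NE normr_eq0.
(* This [d] has modulus 1 and [d h = |h|], so the new corner is [r^2 |h|], which equals 1 for
   [r = |h|^(-1/2)]. *)
pose d := h^* / N%:C%C.
have dC : d^* = h / N%:C%C by rewrite /d rmorphM /= conjCK fmorphV /= conj_Creal ?complex_real.
have d0 : d != 0.
  by apply: mulf_neq0; rewrite ?invr_eq0 ?conjC_eq0 ?h0 ?NC0.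
have hh : h * h^* = N%:C%C * N%:C%C by rewrite -normCK NE expr2.
(* The phase of [d] is already spent on the corner, so the factor [d^*] goes into the matrix to be
   factorized. *)
have [|U [l [U_un l_desc UE]]] := takagi_desc R m (d^* *: (S - h^-1 *: (b *m b^T))).
  by rewrite linearZ linearB linearZ /= trmx_mul trmxK Ssym.
exists l; split=> //; apply/reaches_blockP.
exists (Num.sqrt N)^-1, U, (- h^-1 *: (U *m b)), d; split=> //.
  by rewrite invr_gt0 sqrtr_gt0.
rewrite scalerA mulrN mulfV // scaleN1r subrr scaler0 NFE /= trmx0.
congr block_mx.
- rewrite -UE -scalemxAr -scalemxAl; congr (_ *: _).
  have yT : (- h^-1 *: (U *m b))^T = - h^-1 *: (U *m b)^T by rewrite linearZ.
  have -> : U *m (S - h^-1 *: (b *m b^T)) *m U^T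
      = U *m S *m U^T - h^-1 *: (U *m b *m (U *m b)^T).
    by rewrite mulmxBr mulmxBl -scalemxAr -scalemxAl trmx_mul !mulmxA.
  rewrite yT -!scalemxAr -!scalemxAl !scalerA -!addrA; congr (_ + _).
  by rewrite -scaleNr -!scalerDl; congr (_ *: _); field.
- congr _%:M.
  have ssN : (Num.sqrt N)^-1%:C%C * (Num.sqrt N)^-1%:C%C * N%:C%C = 1.
    rewrite -!rmorphM -invfM -expr2 sqr_sqrtr ?ltW // mulVf ?gt_eqF //.
  rewrite dC /d -[LHS]ssN; move: (_%:C%C) => s.
  have -> : s * (h / N%:C%C) * (h^* / N%:C%C) * s * (h^* / N%:C%C) * h
      = s * s * ((h * h^*) * (h * h^*)) / (N%:C%C * N%:C%C * N%:C%C) by field.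
  by rewrite hh; field.
Qed.

Lemma reaches_flat (m : nat) (S : 'M[R[i]]_m) : S^T = S -> exists l : 'I_m -> R,
  nonneg_desc R m l /\ reaches (block_mx S 0 0 0) (NF Kind2 l).
Proof.
move=> /takagi_desc[U [l [U_un l_desc UE]]]; exists l; split=> //.
have -> : block_mx S 0 0 0 = block_mx S 0 (0 : 'cV_m)^T 0%:M.
  by rewrite trmx0 scalar_mx0.
apply/reaches_blockP; exists 1, U, 0, 1; split=> //; first exact: oner_neq0.
by rewrite /= !rmorph1 scale1r UE !(trmx0, mul0mx, mulmx0, addr0, scaler0, mulr0, scalar_mx0).
Qed.

Lemma evec_last (p : nat) : evec R (p + 1) = col_mx 0 1.
Proof.
apply/colP=> i; rewrite !mxE (_ : (p + 1).-1 = p) ?addn1 //=; case: splitP => k ->; rewrite !mxE /=.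
  by rewrite ltn_eqF.
by rewrite !ord1 addn0 eqxx.
Qed.

(** Only the leading [p] by [p] block [A] needs Takagi: a unitary [diag(U, 1)] fixes [e], and the
    terms [e c^T + c e^T] can cancel the whole last row and column of [S]. For [p = 0] only the zero
    diagonal remains. *)
Lemma reaches_evec (p : nat) (S : 'M[R[i]]_(p + 1)) : S^T = S ->
  exists l : 'I_(p + 1) -> R,
  nf_desc _ Kind1 l /\ reaches (block_mx S (evec R _) (evec R _)^T 0%:M) (NF Kind1 l).
Proof.
move=> Ssym.
have [A [v [w [SE Asym]]]] : exists A v w, S = block_mx A v v^T w%:M /\ A^T = A.
  exists (ulsubmx S), (ursubmx S), (drsubmx S 0 0).
  by rewrite -mx11_scalar trmx_ursub trmx_ulsub Ssym submxK.
have [U [l [U_un [l_ge0 l_desc] UE]]] := takagi_desc R p A Asym.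
exists (fun j => match split j with inl i => l i | inr _ => 0 end); split.
  split; first split.
  - by move=> j; case: splitP.
  - by move=> j k; case: splitP => i ->; case: splitP => i' -> //; [apply: l_desc|
      rewrite ord1 leqNgt ltn_addr].
  - move=> _ j /=; case: splitP => // k ->; rewrite addn1 /= => kp.
    by move: (ltn_ord k); rewrite kp ltnn.
apply/reaches_blockP.
(* The last entry of [c] is [- w / 2] because it enters the corner of [e c^T + c e^T] twice. *)
exists 1, (block_mx U 0 0 1), (col_mx (- (U *m v)) (- (w / 2))%:M), 1; split=> //.
- exact: oner_neq0.
- apply: block_unitary => //; apply/unitarymxP.
  by rewrite trmx1 map_mx1 mulmx1.
have Ue : block_mx U 0 0 1 *m evec R (p + 1) = evec R (p + 1).
  by rewrite evec_last mul_block_col !(mulmx0, mul0mx, mulmx1, add0r).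
rewrite Ue /= !rmorph1 !mulr1 !scale1r !scale0r !addr0.
congr block_mx; last by rewrite mulr0 scalar_mx0.
have -> : Dmx (fun j => match split j with inl i => l i | inr _ => 0 end)
    = block_mx (Dmx l) 0 0 0 :> 'M_(p + 1).
  have D0 : diag_mx 0 = 0 :> 'M[R[i]]_1 by exact: raddf0.
  rewrite /Dmx -D0 -diag_mx_row; congr diag_mx.
  by apply/rowP=> j; rewrite !mxE; case: splitP => k _; rewrite !mxE.
rewrite evec_last SE !(tr_block_mx, tr_col_mx, mulmx_block, mul_col_row, add_block_mx).
rewrite !(trmx0, trmx1, tr_scalar_mx, mulmx0, mul0mx, mulmx1, mul1mx, addr0, add0r) UE.
have vE : (- (U *m v))^T = - (v^T *m U^T) by rewrite linearN /= trmx_mul.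
rewrite vE !subrr -!raddfD /= -addrA -opprD -splitr subrr.
by rewrite scalar_mx0.
Qed.

Lemma reaches_nf_desc (m : nat) (H : 'M[R[i]]_(m + 1)) : (0 < m)%N -> H^T = H ->
  exists (k : nf_kind) (l : 'I_m -> R), nf_desc m k l /\ reaches H (NF k l).
Proof.
move=> m_gt0 Hsym; rewrite -[H]submxK.
have Ssym : (ulsubmx H)^T = ulsubmx H by rewrite trmx_ulsub Hsym.
have <- : (ursubmx H)^T = dlsubmx H by rewrite trmx_ursub Hsym.
rewrite [drsubmx H]mx11_scalar; move: (drsubmx H 0 0) => h.
move: (ulsubmx H) (ursubmx H) Ssym => S b Ssym {H Hsym}.
have [-> | h0] := eqVneq h 0; last first.
  have [l [l_desc lE]] := reaches_corner m S b h Ssym h0.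
  by exists Kind3, l.
have [-> | b0] := eqVneq b 0.
  have [l [l_desc lE]] := reaches_flat m S Ssym.
  by exists Kind2, l; rewrite trmx0 scalar_mx0.
exists Kind1.
have [p mE] : exists p, m = (p + 1)%N by exists m.-1; rewrite addn1 prednK.
subst m.
pose last : 'I_(p + 1) := rshift p ord0.
(* The last row of [U] is to be [t b^*]: then [t b] is the last column of [U^*], whence
   [U (t b) = e]. *)
have bC0 : (mxC b)^T != 0.
  by rewrite -trmx0 (inj_eq (@trmx_inj _ _ _)) map_mx_eq0.
have [U [t [U_un t_gt0 rowU]]] := unitary_row_ext _ _ _ last bC0.
have tC : t^* = t by apply: conj_Creal; apply: gtr0_real.
have tE : (complex.Re t)%:C%C = t by rewrite RRe_real // gtr0_real.
have colU : col last (mxC U^T) = t *: b.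
  apply/colP=> j; have /rowP/(_ j) := rowU; rewrite !mxE => ->.
  by rewrite rmorphM /= tC conjCK.
have Ub : U *m (t *: b) = evec R (p + 1).
  rewrite -colU colE mulmxA (unitarymxP U_un) mul1mx.
  apply/colP=> j; rewrite !mxE (_ : (p + 1).-1 = p) ?addn1 //= eqxx andbT.
  by rewrite -val_eqE /= addn0; case: (_ == _).
have [l [l_desc lE]] := reaches_evec p (U *m S *m U^T)
  ltac:(by rewrite !trmx_mul trmxK Ssym mulmxA).
exists l; split=> //; apply: reaches_trans lE; apply/reaches_blockP.
(* With [d = 1], [c = 0] and zero corner the column becomes [r U b], so [r = t] produces [e]
   exactly. *)
exists (complex.Re t), U, 0, 1; split=> //.
- by rewrite -ltcR tE.
- exact: oner_neq0.
- rewrite /= tE !rmorph1 !mulr1 scale1r !scale0r !addr0 mulr0 scalemxAr Ub.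
  by rewrite trmx0 mulmx0 mul0mx !addr0.
Qed.

End NormalForms.

(** * Rescaling of normal forms, and uniqueness up to rescaling *)

Section Uniqueness.
Variable R : rcfType.
Local Notation mxC := (map_mx Num.conj).

(** Taking [U = 1], [c = 0], [d = t] multiplies the diagonal block by [t], the column by [r t^2] and
    the corner by [r^2 t^3]; [r] is chosen to make the relevant one of the last two factors 1. *)
Lemma reaches_scale (m : nat) (k : nf_kind) (l : 'I_m -> R) (t : R) : 0 < t ->
  reaches (NF k l) (NF k (fun j => t * l j)).
Proof.
move=> t0; pose r := match k with
  | Kind1 => (t ^+ 2)^-1 | Kind2 => 1 | Kind3 => (Num.sqrt t * t)^-1 end.
have s0 : 0 < Num.sqrt t by rewrite sqrtr_gt0.
have r0 : 0 < r by rewrite /r; case: (k); rewrite ?invr_gt0 ?exprn_gt0 ?mulr_gt0.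
have colE : (r%:C%C * t%:C%C * t%:C%C) *: nf_col R m k = nf_col R m k.
  rewrite -!rmorphM /r /nf_col; case: (k); rewrite ?scaler0 //.
  by rewrite -mulrA -expr2 mulVf ?rmorph1 ?scale1r // expf_neq0 ?gt_eqF.
have cornerE : r%:C%C * t%:C%C * t%:C%C * r%:C%C * t%:C%C * nf_corner R k = nf_corner R k.
  rewrite -!rmorphM /r /nf_corner; case: (k); rewrite ?mulr0 // mulr1.
  have -> : (Num.sqrt t * t)^-1 * t * t * (Num.sqrt t * t)^-1 * t = t / Num.sqrt t ^+ 2.
    by field; rewrite !gt_eqF.
  by rewrite sqr_sqrtr ?ltW // mulfV ?gt_eqF.
rewrite !NFE; apply/reaches_blockP; exists r, 1%:M, 0, t%:C%C; split=> //.
- by rewrite -(rmorph0 (real_complex R)) (inj_eq (@complexI R)) gt_eqF.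
- by apply/unitarymxP; rewrite trmx1 map_mx1 mulmx1.
rewrite /= conj_Creal ?complex_real // trmx1 !mul1mx mulmx1 trmx0 mulmx0 !mul0mx.
rewrite !scaler0 !addr0 colE cornerE; congr block_mx.
by apply/matrixP=> i j; rewrite !mxE rmorphM -mulrnAr.
Qed.

Lemma evec_neq0 (m : nat) : (0 < m)%N -> evec R m != 0.
Proof.
case: m => // m _; apply/eqP=> /colP/(_ ord_max); rewrite !mxE eqxx => /eqP.
by rewrite oner_eq0.
Qed.

Lemma evec_dot (m : nat) : (0 < m)%N -> (evec R m)^T *m evec R m = 1%:M.
Proof.
case: m => // m _; apply/matrixP=> i j; rewrite !ord1 !mxE (bigD1 ord_max) //=.
rewrite !mxE eqxx mulr1 big1 ?addr0 // => k; rewrite -val_eqE /= => /negPf kN.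
by rewrite !mxE kN mulr0.
Qed.

Lemma Dmx_mul_evec (m : nat) (l : 'I_m -> R) :
  (forall j : 'I_m, val j = m.-1 -> l j = 0) -> Dmx l *m evec R m = 0.
Proof.
move=> l0; apply/colP=> j; rewrite mul_diag_mx !mxE.
by case: eqP => [/l0 ->|_]; rewrite ?mul0r ?mulr0.
Qed.

(* [1 - e e^T] annihilates the two rank-one terms and fixes both the left hand
   side and [U D U^T], because [e] is an eigenvector of [U], hence of [U^*]. *)
Lemma evec_congr_drop (m : nat) (l l' : 'I_m -> R) (U : 'M[R[i]]_m)
    (c : 'cV[R[i]]_m) (z k : R[i]) : (0 < m)%N -> U \is unitarymx -> k != 0 ->
  (forall j : 'I_m, val j = m.-1 -> l j = 0) ->
  (forall j : 'I_m, val j = m.-1 -> l' j = 0) ->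
  evec R m = k *: (U *m evec R m) ->
  Dmx l' = z *: (U *m Dmx l *m U^T + U *m evec R m *m c^T + c *m (U *m evec R m)^T) ->
  Dmx l' = z *: (U *m Dmx l *m U^T).
Proof.
move=> m0 U_un k0 l0 l'0 eE.
have := Dmx_mul_evec m l l0; have := Dmx_mul_evec m l' l'0.
have := evec_dot m m0; have eC : mxC (evec R m) = evec R m.
  by apply/colP=> j; rewrite !mxE; case: ifP => _; rewrite ?conjC1 ?conjC0.
move: (evec R m) eC eE => e eC eE ee D'e De.
have Ue : U *m e = k^-1 *: e by rewrite [in RHS]eE scalerA mulVf // scale1r.
have DT (f : 'I_m -> R) : (Dmx f)^T = Dmx f by rewrite tr_diag_mx.
have eD : e^T *m Dmx l = 0 by rewrite -[Dmx l]DT -trmx_mul De trmx0.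
have eD' : e^T *m Dmx l' = 0 by rewrite -[Dmx l']DT -trmx_mul D'e trmx0.
have eU : e^T *m U = k^* *: e^T.
  have UtU : mxC U^T *m U = 1%:M by apply: mulmx1C; apply/unitarymxP.
  have Ute : mxC U^T *m e = k *: e.
    by rewrite {1}eE -scalemxAr mulmxA UtU mul1mx.
  have eTC : mxC e^T = e^T by rewrite -map_trmx eC.
  have UCC : mxC (mxC U^T)^T = U by apply/matrixP=> i j; rewrite !mxE conjCK.
  by rewrite -{1}eTC -{1}UCC -map_mxM -trmx_mul Ute linearZ /= map_mxZ /= eTC.
pose P : 'M[R[i]]_m := 1%:M - e *m e^T.
have Pe : P *m e = 0 by rewrite mulmxBl mul1mx -mulmxA ee mulmx1 subrr.
have PT : P^T = P by rewrite linearB /= trmx1 trmx_mul trmxK.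
have PD' : P *m Dmx l' = Dmx l' by rewrite mulmxBl mul1mx -mulmxA eD' mulmx0 subr0.
have PUD : P *m (U *m Dmx l) = U *m Dmx l.
  rewrite mulmxBl mul1mx -(mulmxA e) (mulmxA e^T) eU -scalemxAl eD scaler0.
  by rewrite mulmx0 subr0.
have PUDU : P *m (U *m Dmx l *m U^T) *m P^T = U *m Dmx l *m U^T.
  have UDU : (U *m Dmx l *m U^T)^T = U *m Dmx l *m U^T.
    by rewrite !trmx_mul trmxK DT mulmxA.
  by rewrite mulmxA PUD -[in LHS]UDU -trmx_mul mulmxA PUD UDU.
have PDP : P *m Dmx l' *m P^T = Dmx l'.
  by rewrite PD' -[in LHS](DT l') -trmx_mul PD' DT.
move=> E; clearbody P; rewrite -PDP E -scalemxAr -scalemxAl; congr (_ *: _).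
have PUe : P *m (U *m e) = 0 by rewrite Ue -scalemxAr Pe scaler0.
rewrite !mulmxDr !mulmxDl PUDU !mulmxA -(mulmxA P U) PUe !mul0mx addr0.
by rewrite -(mulmxA _ _ P^T) -trmx_mul PUe trmx0 mulmx0 addr0.
Qed.

(** Comparing corners and then columns shows that the kinds agree. In each kind the terms involving
    [c] drop out of the diagonal block, leaving a unitary congruence scaled by [d^*]. *)
Lemma nf_desc_unique (m : nat) (k k' : nf_kind) (l l' : 'I_m -> R) :
  (0 < m)%N -> nf_desc R m k l -> nf_desc R m k' l' -> reaches (NF k l) (NF k' l') ->
  k = k' /\ exists2 t : R, 0 < t & forall j, l' j = t * l j.
Proof.
move=> m0 [l_desc l_last] [l'_desc l'_last]; rewrite !NFE.
case/reaches_blockP=> r [U [c [d [r0 d0 U_un]]]] /eq_block_mx[].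
set K := r%:C%C * d^* * d.
have rC0 : r%:C%C != 0 by rewrite -(rmorph0 (real_complex R)) (inj_eq (@complexI R)) gt_eqF.
have K0 : K != 0 by rewrite !mulf_neq0 ?conjC_eq0.
move: K K0 => K K0.
have dC0 : d^* != 0 by rewrite conjC_eq0.
move=> E1 E2 _ /matrixP/(_ 0 0); rewrite !mxE !mulr1n => E4.
have kind3 : (nf_corner R k == 0) = (nf_corner R k' == 0).
  by rewrite E4 !mulf_eq0 (negPf K0) (negPf rC0) (negPf d0).
(* With zero corner the new column is [K U b], and the invertible [U] preserves the rank of [b]. *)
have colE : nf_corner R k = 0 -> (nf_col R m k == 0) = (nf_col R m k' == 0).
  move=> h0; rewrite E2 h0 scale0r addr0 scaler_eq0 (negPf K0) /=.
  by rewrite -!mxrank_eq0 eqmxMfull // row_full_unit unitarymx_unit.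
have kk' : k = k'.
  move: kind3 colE; rewrite /nf_corner /nf_col; have /negPf e0 := evec_neq0 m m0.
  by case: (k); case: (k') => //; rewrite ?eqxx ?oner_eq0 ?e0 => // _ /(_ erefl).
split=> //; subst k'; apply: (Dmx_congr_scale R m l l' U d^*) => //.
move: E1 E2 l_last l'_last; case: (k); rewrite /nf_col /nf_corner => E1 E2 l_last l'_last.
- apply: (evec_congr_drop m l l' U c d^* K) => //; [exact: l_last|exact: l'_last|..].
    by move: E2; rewrite scale0r addr0.
  by move: E1; rewrite scale0r addr0.
- by move: E1; rewrite !mulmx0 trmx0 mulmx0 mul0mx scale0r !addr0.
(* Both columns vanish and the corner is 1, so the column equation reads [0 = K c]. *)
- have c0 : c = 0.
    move/esym/eqP: E2; rewrite mulmx0 add0r scale1r scaler_eq0 (negPf K0) /=.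
    by move/eqP.
  by move: E1; rewrite c0 !mulmx0 !trmx0 !mulmx0 scaler0 !addr0.
Qed.

End Uniqueness.

(** * Normalizing the leading entry of the diagonal *)

Section Validity.
Variable R : rcfType.

Lemma nf_valid_chain (m : nat) (k : nf_kind) (l : 'I_m -> R) :
  nf_valid k l -> (forall j, l j = 0) \/ lam_chain l.
Proof. by case=> [l0|]; [left | case: k => [[]||]; right]. Qed.

Lemma nf_valid_desc (m : nat) (k : nf_kind) (l : 'I_m -> R) :
  nf_valid k l -> nf_desc R m k l.
Proof.
move=> lv; split.
  case: (nf_valid_chain m k l lv) => [l0|[l01 l_desc _]].
    by split=> *; rewrite !l0.
  by split=> // j; case/andP: (l01 j).
by move=> kE j jE; case: lv => [->//|]; rewrite kE => -[_]; apply.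
Qed.

(** The entry of index 0 is the largest: if it vanishes so do all the others, and otherwise dividing
    by it gives leading entry 1. *)
Lemma nf_desc_normalize (m : nat) (k : nf_kind) (l : 'I_m -> R) :
  (0 < m)%N -> nf_desc R m k l ->
  exists2 t : R, 0 < t & nf_valid k (fun j => t * l j).
Proof.
move=> m0 [[l_ge0 l_desc] l_last]; pose j0 := Ordinal m0.
have l_le0 j : l j <= l j0 by apply: l_desc.
have [l00 | l00] := eqVneq (l j0) 0.
  exists 1 => //; left=> j; rewrite mul1r; apply/eqP.
  by rewrite eq_le l_ge0 -l00 l_le0.
have l0_gt0 : 0 < l j0 by rewrite lt0r l00 l_ge0.
have t0 : 0 < (l j0)^-1 by rewrite invr_gt0.
exists (l j0)^-1 => //; right.
have ch : lam_chain (fun j => (l j0)^-1 * l j).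
  split.
  - by move=> j; rewrite mulr_ge0 ?l_ge0 ?(ltW t0) //= mulrC ler_pdivrMr // mul1r l_le0.
  - by move=> j i ji; rewrite ler_pM2l // l_desc.
  - move=> j jE; have -> : j = j0 by apply: val_inj.
    by rewrite mulVf.
case: k l_last => // l_last; split=> // j jE.
by rewrite (l_last erefl j jE) mulr0.
Qed.

(** Either [l] vanishes, and then so does [l'], or [l] starts with 1 and [l'] with [t]; being
    nonzero, that entry is 1 as well. *)
Lemma nf_valid_scale_eq (m : nat) (k k' : nf_kind) (l l' : 'I_m -> R) (t : R) :
  (0 < m)%N -> 0 < t -> nf_valid k l -> nf_valid k' l' ->
  (forall j, l' j = t * l j) -> forall j, l' j = l j.
Proof.
move=> m0 t0 lv l'v E j; pose j0 := Ordinal m0.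
case: (nf_valid_chain m k l lv) => [l0|[_ _ /(_ j0 erefl) l1]].
  by rewrite E l0 mulr0.
case: (nf_valid_chain m k' l' l'v) => [/(_ j0)|[_ _ /(_ j0 erefl)]].
  by rewrite E l1 mulr1 => t00; rewrite t00 ltxx in t0.
by rewrite E l1 mulr1 => t1; rewrite E t1 mul1r.
Qed.

End Validity.

(** * Existence and uniqueness of the normal form *)

Theorem theorem5p8 (R : realType) (n : nat) (hn : (2 <= n)%N)
  (H : 'M[R[i]]_(n.-1 + 1)) :
  H^T = H ->
  exists (k : nf_kind) (l : 'I_n.-1 -> R),
    [/\ nf_valid k l, reaches H (NF k l)
      & forall (k' : nf_kind) (l' : 'I_n.-1 -> R),
          nf_valid k' l' -> reaches H (NF k' l') ->
          k' = k /\ (forall j, l' j = l j)].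
Proof.
have : (0 < n.-1)%N by case: n hn {H} => [|[|n]].
move: n.-1 H => m H m_gt0 Hsym.
have [k [l0 [l0_desc Hl0]]] := reaches_nf_desc R m H m_gt0 Hsym.
have [t t_gt0 lv] := nf_desc_normalize R m k l0 m_gt0 l0_desc.
have Hl := reaches_trans R m _ _ _ Hl0 (reaches_scale R m k l0 t t_gt0).
exists k, (fun j => t * l0 j); split=> // k' l' l'v Hl'.
(* Two normal forms in the orbit of [H] are linked through [H], so uniqueness only compares normal
   forms with each other. *)
have ll' := reaches_trans R m _ _ _ (reaches_sym R m _ _ Hl) Hl'.
have [-> [s s_gt0 sE]] := nf_desc_unique R m k k' _ l' m_gt0
  (nf_valid_desc R m k _ lv) (nf_valid_desc R m k' l' l'v) ll'.
by split=> //; apply: nf_valid_scale_eq lv l'v sE.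
Qed.
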